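(* Let $L$ be a multiplicative lattice with infinite $m$-distributivity, let $n\in L$, and consider the open subspace $\mathrm{D}_L(n):=\mathrm{Spec}(L)\setminus\mathrm{V}_L(n)$ of $\mathrm{Spec}(L)$. Then the mapping $$\varphi\colon \mathrm{D}_L(n)\to\mathrm{Spec}([0,n]_L),\qquad p\mapsto p\wedge n,$$ is a homeomorphism.
   Context: A multiplicative lattice $(L,\vee,\cdot)$ is a complete lattice $L$ (least element $0$, largest element $1$) with a binary operation $\cdot\colon L\times L\to L$ such that $xy\leqslant x$ and $xy\leqslant y$ for all $x,y\in L$. It has infinite $m$-distributivity if $\left(\bigvee X\right)\left(\bigvee Y\right)=\bigvee_{(x,y)\in X\times Y}xy$ for all subsets $X,Y$ of $L$. An element $p$ of a multiplicative lattice, different from its largest element, is prime if, for all $x,y$ in the lattice, $xy\leqslant p$ implies $x\leqslant p$ or $y\leqslant p$. $\mathrm{Spec}(L)$ is the set of prime elements of $L$, with the Zariski topology, whose closed sets are the sets $\mathrm{V}_L(x):=\{p\in\mathrm{Spec}(L)\mid x\leqslant p\}$, $x\in L$. The interval $[0,n]_L:=\{z\in L\mid z\leqslant n\}$ is a multiplicative lattice with the restriction of the multiplication of $L$ (its largest element is $n$); $\mathrm{Spec}([0,n]_L)$ is its prime spectrum with its own Zariski topology. *)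

(* Defs.v *)
From HB Require Import structures.
From mathcomp Require Import all_boot all_order.
From mathcomp Require Import boolp classical_sets functions topology.

Set Implicit Arguments.
Unset Strict Implicit.
Unset Printing Implicit Defensive.

Import Order.TTheory.
Local Open Scope classical_set_scope.
Local Open Scope order_scope.

(* Finite meets and joins, bottom and top are those of [tbLatticeType]; since
   [supremums X] has at most one element, [bigjoin] is uniquely determined by
   the order.  The empty family is included. *)
HB.mixin Record TBLattice_isComplete d L of Order.TBLattice d L := {
  bigjoin : set L -> L;
  bigjoin_supremum : forall X : set L, supremums X (bigjoin X)
}.

#[short(type="completeLatticeType")]
HB.structure Definition CompleteLattice d :=
  {L of Order.TBLattice d L & TBLattice_isComplete d L}.

(* No associativity, commutativity or unit is assumed. *)
HB.mixin Record CompleteLattice_isMultiplicative d L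
    of CompleteLattice d L := {
  mmul : L -> L -> L;
  le_mmull : forall x y : L, mmul x y <= x;
  le_mmulr : forall x y : L, mmul x y <= y
}.

#[short(type="multLatticeType")]
HB.structure Definition MultLattice d :=
  {L of CompleteLattice d L & CompleteLattice_isMultiplicative d L}.

Definition infinite_m_distributive d (L : multLatticeType d) : Prop :=
  forall X Y : set L,
    mmul (bigjoin X) (bigjoin Y) = bigjoin [set mmul x y | x in X & y in Y].

Definition prime_element d (L : multLatticeType d) (p : L) : Prop :=
  p <> \top /\ forall x y : L, mmul x y <= p -> x <= p \/ y <= p.

Definition Spec d (L : multLatticeType d) : Type :=
  {p : L | p \in [set p | prime_element p]}.

HB.instance Definition _ d (L : multLatticeType d) := SubChoice.on (Spec L).

Definition specV d (L : multLatticeType d) (x : L) : set (Spec L) :=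
  [set p | x <= \val p].

Definition specD d (L : multLatticeType d) (x : L) : set (Spec L) :=
  ~` specV x.

Section ZariskiTopology.
Context {d : Order.disp_t} {L : multLatticeType d}.

Lemma Spec_prime (p : Spec L) : prime_element (\val p).
Proof. exact: set_mem (valP p). Qed.

Definition zariski_open (U : set (Spec L)) : Prop := exists x, U = specD x.

Lemma zariski_openT : zariski_open setT.
Proof.
exists \top; apply/seteqP; split => // p _ /=; rewrite /specD /specV /= => tp.
by have [pN1 _] := Spec_prime p; apply/pN1/eqP; rewrite -le1x.
Qed.

Lemma zariski_openI : setI_closed zariski_open.
Proof.
move=> _ _ [x ->] [y ->]; exists (mmul x y).
rewrite /specD -setCU; congr (~` _); apply/seteqP; split => p /=.
  by case; apply: le_trans; [exact: le_mmull|exact: le_mmulr].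
by have [_ pP] := Spec_prime p; exact: pP.
Qed.

Lemma zariski_open_bigU (I : Type) (f : I -> set (Spec L)) :
  (forall i, zariski_open (f i)) -> zariski_open (\bigcup_i f i).
Proof.
move=> /choice[x fE]; exists (bigjoin (range x)).
have [ubx lubx] := bigjoin_supremum (range x).
apply/seteqP; split => p; rewrite /specD /specV /=.
  case=> i _; rewrite fE => xip xp; apply: xip => /=.
  by apply: le_trans xp; apply: ubx; exists i.
move=> xp; apply: contrapT => pN; apply: xp; apply: lubx => _ [i _ <-].
by apply: contrapT => xip; apply: pN; exists i => //; rewrite fE.
Qed.

HB.instance Definition _ :=
  isOpenTopological.Build (Spec L)
    zariski_openT zariski_openI zariski_open_bigU.

Lemma open_zariskiE : (open : set (set (Spec L))) = zariski_open.
Proof. by []. Qed.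

Lemma closed_zariskiP (C : set (Spec L)) : closed C <-> exists x, C = specV x.
Proof.
rewrite -openC open_zariskiE /zariski_open /specD.
split => -[x]; last by move=> ->; exists x.
by move=> /(congr1 setC); rewrite !setCK; exists x.
Qed.

Lemma open_specD (x : L) : open (specD x : set (Spec L)).
Proof. by rewrite open_zariskiE; exists x. Qed.

End ZariskiTopology.

Definition lower d (L : multLatticeType d) (n : L) : Type := {z : L | z <= n}.

Section LowerInterval.
Context {d : Order.disp_t} {L : multLatticeType d} (n : L).
Local Notation N := (lower n).

HB.instance Definition _ := SubChoice.on N.
HB.instance Definition _ := [SubChoice_isSubPOrder of N by <: with d].

Fact lower_meet_closed : meet_closed [pred z : L | z <= n].
Proof. by move=> x y xn _; rewrite inE leIxl. Qed.

Fact lower_join_closed : join_closed [pred z : L | z <= n].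
Proof. by move=> x y xn yn; rewrite inE leUx; apply/andP. Qed.

HB.instance Definition _ := Order.SubPOrder_isSubLattice.Build d L
  (fun z : L => z <= n) d N lower_meet_closed lower_join_closed.

Definition in_lower : forall z : L, z <= n -> N := exist (fun z : L => z <= n).

Definition lower_bot : N := in_lower (le0x n).
Definition lower_top : N := in_lower (lexx n).

Fact lower_le0x (x : N) : lower_bot <= x.
Proof. by rewrite -Order.le_val /= le0x. Qed.

Fact lower_lex1 (x : N) : x <= lower_top.
Proof. by rewrite -Order.le_val /=; exact: (valP x). Qed.

HB.instance Definition _ := Order.hasBottom.Build d N lower_le0x.
HB.instance Definition _ := Order.hasTop.Build d N lower_lex1.

Fact lower_bigjoin_le (X : set N) : bigjoin (\val @` X) <= n.
Proof.
have [_ lub] := bigjoin_supremum (\val @` X : set L).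
by apply: lub => _ [x _ <-]; exact: (valP x).
Qed.

Definition lower_bigjoin (X : set N) : N := in_lower (lower_bigjoin_le X).

Fact lower_bigjoin_supremum (X : set N) : supremums X (lower_bigjoin X).
Proof.
have [ub lub] := bigjoin_supremum (\val @` X : set L); split.
  by move=> x Xx; rewrite -Order.le_val /=; apply: ub; exists x.
move=> y yub; rewrite -Order.le_val /=; apply: lub => _ [x Xx <-].
by rewrite Order.le_val; exact: yub.
Qed.

HB.instance Definition _ :=
  TBLattice_isComplete.Build d N lower_bigjoin_supremum.

Fact lower_mmul_le (x y : N) : mmul (\val x) (\val y) <= n.
Proof. exact: le_trans (le_mmull _ _) (valP x). Qed.

Definition lower_mmul (x y : N) : N := in_lower (lower_mmul_le x y).

Fact lower_mmull (x y : N) : lower_mmul x y <= x.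
Proof. by rewrite -Order.le_val /=; exact: le_mmull. Qed.

Fact lower_mmulr (x y : N) : lower_mmul x y <= y.
Proof. by rewrite -Order.le_val /=; exact: le_mmulr. Qed.

HB.instance Definition _ :=
  CompleteLattice_isMultiplicative.Build d N lower_mmull lower_mmulr.

End LowerInterval.

Definition homeomorphism (S T : topologicalType) (f : S -> T) : Prop :=
  continuous f /\
  exists g : T -> S, [/\ cancel f g, cancel g f & continuous g].

(* Main.v *)
(** The inverse of [p |-> p /\ n] sends a prime [q] of [[0,n]] to the residual
    [q : n], the join of all [z] with [z n <= q].  Infinite distributivity makes
    this a residual: [z <= (q : n)] iff [z n <= q].  If [u <= n] and [u n <= q]
    then [u <= q] by primality of [q]; applied to [u = (x n)(y n)] this yields
    primality of [q : n] without associativity or commutativity, and applied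
    to [u = (q : n) /\ n] it yields [(q : n) /\ n = q].  Both maps are continuous
    since they pull [V(x)] back to [V(x)] and [V(x n)] respectively. *)
Require Import Defs.
From mathcomp Require Import all_boot all_order.
From mathcomp Require Import boolp classical_sets functions topology.

Import Order.TTheory.
Local Open Scope classical_set_scope.
Local Open Scope order_scope.

Section BigJoin.
Context {d : Order.disp_t} {L : multLatticeType d}.
Implicit Types (x y z : L) (X : set L).

Lemma le_bigjoin X x : X x -> x <= bigjoin X.
Proof. by have [+ _] := bigjoin_supremum X; exact. Qed.

Lemma bigjoin_le X y : (forall x, X x -> x <= y) -> bigjoin X <= y.
Proof. by have [_ +] := bigjoin_supremum X; exact. Qed.

Lemma bigjoin_set1 x : bigjoin [set x] = x.
Proof.
by apply/le_anti/andP; split; [apply: bigjoin_le => _ ->|exact: le_bigjoin].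
Qed.

Hypothesis distrL : infinite_m_distributive L.

(** Distributivity with [y] written as the join of [[set y]]. *)
Lemma mmul_bigjoinl X y : mmul (bigjoin X) y = bigjoin [set mmul x y | x in X].
Proof.
rewrite -{1}(bigjoin_set1 y) distrL; congr bigjoin.
apply/seteqP; split => [_ [x Xx [_ -> <-]]|_ [x Xx <-]]; first by exists x.
by exists x => //; exists y.
Qed.

(** Write [x'] and [y'] as joins of [[set x; x']] and [[set y; y']]: the expanded product has
    [mmul x y] among its terms. *)
Lemma le_mmul x x' y y' : x <= x' -> y <= y' -> mmul x y <= mmul x' y'.
Proof.
have joinE (u v : L) : u <= v -> bigjoin [set u; v] = v.
  move=> uv; apply/le_anti/andP; split; last by apply: le_bigjoin; right.
  by apply: bigjoin_le => _ [] ->.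
move=> /joinE <- /joinE <-; rewrite distrL; apply: le_bigjoin.
by exists x; [left|exists y => //; left].
Qed.

Definition residual x y : L := bigjoin [set z | mmul z y <= x].

Lemma le_residual x y z : (z <= residual x y) = (mmul z y <= x).
Proof.
apply/idP/idP => [zr|zyx]; last exact: le_bigjoin.
apply: le_trans (le_mmul _ _ _ _ zr (lexx y)) _.
by rewrite mmul_bigjoinl; apply: bigjoin_le => _ [w wy <-].
Qed.

End BigJoin.

(** Right factors outside [p] cancel; used in [L] with factor [n] and in the interval with its
    top. *)
Lemma le_mmul_prime {d} {L : multLatticeType d} (p : Spec L) (x y : L) :
  ~~ (y <= \val p) -> (mmul x y <= \val p) = (x <= \val p).
Proof.
move=> yp; apply/idP/idP => [|xp]; last exact: le_trans (le_mmull _ _) xp.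
have [_ pP] := Spec_prime p => /pP[//|].
by rewrite (negbTE yp).
Qed.

(** Every Zariski open set is itself some [specD x], so these preimages are all there is to
    check. *)
Lemma continuous_to_Spec {d} {L : multLatticeType d} (T : topologicalType)
    (f : T -> Spec L) :
  (forall x, open (f @^-1` specD x)) -> continuous f.
Proof. by move=> fD; apply/continuousP => _ [x ->]; exact: fD. Qed.

Section LowerSpec.
Context {d : Order.disp_t} {L : multLatticeType d} (n : L).

Lemma specD_nle (p : @specD d L n) : ~~ (n <= \val (\val p)).
Proof. by apply/negP; have := set_mem (valP p). Qed.

(** Elements of the interval lie below [n], so for them being below the meet amounts to being below
    [p]. *)
Lemma prime_meet (p : @specD d L n) :
  prime_element (in_lower (leIr n (\val (\val p))) : lower n).
Proof.
split=> [/(congr1 val) /= pn|x y].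
  by have /negP := specD_nle p; apply; rewrite leEmeet meetC pn.
rewrite -!Order.le_val /= => xyp.
have [_ /(_ (\val x) (\val y))] := Spec_prime (\val p).
rewrite !lexI (valP x : \val x <= n) (valP y : \val y <= n) !andbT.
by apply; exact: le_trans xyp (leIl _ _).
Qed.

Definition meet_spec (p : @specD d L n) : Spec (lower n) :=
  exist _ (in_lower (leIr n (\val (\val p)))) (mem_set (prime_meet p)).

Hypothesis distrL : infinite_m_distributive L.

Section Residual.
Variable q : Spec (lower n).

Lemma le_mmul_lower_prime (u : L) :
  u <= n -> (mmul u n <= \val (\val q)) = (u <= \val (\val q)).
Proof.
move=> un; have ntop : ~~ (\top <= \val q).
  by have [qN1 _] := Spec_prime q; apply/negP; rewrite le1x => /eqP.
by have := le_mmul_prime q (in_lower un) _ ntop; rewrite -!Order.le_val.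
Qed.

Lemma residual_nle : ~~ (n <= residual (\val (\val q)) n).
Proof.
rewrite le_residual// le_mmul_lower_prime//; apply/negP => nq.
have [qN1 _] := Spec_prime q; apply/qN1/val_inj/le_anti.
by rewrite (valP (\val q) : \val (\val q) <= n).
Qed.

Lemma prime_residual : prime_element (residual (\val (\val q)) n).
Proof.
split=> [rT|x y]; first by have := residual_nle; rewrite rT lex1.
rewrite !le_residual// => xyq.
set xn := in_lower (le_mmulr x n); set yn := in_lower (le_mmulr y n).
have [_ /(_ xn yn)] := Spec_prime q; rewrite -!Order.le_val; apply.
(* A further factor [n] makes monotonicity applicable: [((x n)(y n)) n <= (x y) n]. *)
rewrite -le_mmul_lower_prime; last exact: le_trans (le_mmull _ _) (valP xn).
by apply: le_trans xyq; rewrite !le_mmul ?le_mmull.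
Qed.

Definition residual_prime : Spec L :=
  exist _ (residual (\val (\val q)) n) (mem_set prime_residual).

Lemma specD_residual_prime : specD n residual_prime.
Proof. exact/negP/residual_nle. Qed.

Definition residual_spec : @specD d L n :=
  exist _ residual_prime (mem_set specD_residual_prime).

Lemma residual_meet : residual (\val (\val q)) n `&` n = \val (\val q).
Proof.
have qn : \val (\val q) <= n := valP (\val q).
apply/le_anti/andP; split.
  by rewrite -le_mmul_lower_prime ?leIr// -le_residual// leIl.
by rewrite lexI qn andbT le_residual// le_mmull.
Qed.

End Residual.

Lemma meet_specK : cancel meet_spec residual_spec.
Proof.
move=> p; do 2!apply: val_inj => /=; apply: le_anti; apply/andP; split.
  (* As [n] is not below [p], it suffices to bound the residual of the meet by that of [p]. *)
  rewrite -(le_mmul_prime (\val p) _ n) ?specD_nle// -le_residual//.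
  by apply: bigjoin_le => z /= zn; apply: le_bigjoin; exact: le_trans zn (leIl _ _).
by rewrite le_residual//= lexI le_mmull le_mmulr.
Qed.

Lemma residual_specK : cancel residual_spec meet_spec.
Proof. by move=> q; do 2!apply: val_inj; exact: residual_meet. Qed.

Lemma continuous_meet_spec : continuous meet_spec.
Proof.
(* Since [x <= n], the preimage is the trace on D(n) of the ambient open set D(x). *)
apply: continuous_to_Spec => x; exists (specD (\val x)); first exact: open_specD.
apply/seteqP; split => p; rewrite /specD /specV /= -Order.le_val /= lexI;
  by rewrite (valP x : \val x <= n) andbT.
Qed.

Lemma continuous_residual_spec : continuous residual_spec.
Proof.
(* D(n) has the initial topology of its inclusion, so continuity is tested in [Spec L]. *)
apply: continuous_comp_initial; apply: continuous_to_Spec => x.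
rewrite (_ : _ @^-1` _ = specD (in_lower (le_mmulr x n))); first exact: open_specD.
by apply/seteqP; split => q; rewrite /specD /specV /= -Order.le_val /= le_residual.
Qed.

End LowerSpec.

Theorem theorem8p4 (d : Order.disp_t) (L : multLatticeType d) (n : L) :
  infinite_m_distributive L ->
  exists phi : specD n -> Spec (lower n),
    (forall p : specD n,
       \val (\val (phi p)) = Order.meet (\val (\val p)) n) /\
    homeomorphism phi.
Proof.
move=> distrL; exists (meet_spec n); split=> //.
split; first exact: continuous_meet_spec.
exists (residual_spec n distrL); split.
- exact: meet_specK.
- exact: residual_specK.
- exact: continuous_residual_spec.
Qed.
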